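(* Let $A\in\mathbb{B}(\mathscr{H})$ and let $B\in\mathbb{B}(\mathscr{H})$ be a generalized projection. Then $B\stackrel{*}{\leq}A$ if and only if there exists $X\in\mathbb{B}(\mathscr{H})$ such that $A=B+(I-BB^* )X(I-B^*B)$.
   Context: $\mathscr{H}$ is a complex Hilbert space, $\mathbb{B}(\mathscr{H})$ is the space of bounded linear operators on $\mathscr{H}$, and $I$ is the identity operator. An operator $B\in\mathbb{B}(\mathscr{H})$ is a generalized projection if $B^2=B^*$. For $C,D\in\mathbb{B}(\mathscr{H})$, the $*$-order $C\stackrel{*}{\leq}D$ means $CC^*=DC^*$ and $C^*C=C^*D$. *)

(* Defs.v *)
From HB Require Import structures.
From mathcomp Require Import all_boot all_order all_algebra.
From mathcomp Require Import sesquilinear complex.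
From mathcomp Require Import all_classical all_reals all_analysis.

Set Implicit Arguments.
Unset Strict Implicit.
Unset Printing Implicit Defensive.

Import Order.TTheory GRing.Theory Num.Theory.
Import numFieldNormedType.Exports.

Local Open Scope classical_set_scope.
Local Open Scope ring_scope.

(* The inner product is linear in its first argument and conjugate-linear in
   the second, and it induces the norm of the underlying Banach space. *)
HB.mixin Record isHilbert (R : realType) H & CompleteNormedModule R[i] H := {
  inner : {dot H for Num.conj} ;
  inner_normE : forall x : H, inner x x = `|x| ^+ 2
}.

#[short(type="hilbertType")]
HB.structure Definition Hilbert (R : realType) :=
  {H of CompleteNormedModule R[i] H & isHilbert R H}.

Record bounded_operator (R : realType) (H : hilbertType R) := BoundedOperator {
  bop_fun :> H -> H ;
  bop_linear : linear bop_fun ;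
  bop_bounded : bounded_near bop_fun (nbhs (0 : H))
}.

Notation "''B' ( H )" := (bounded_operator H)
  (at level 8, format "''B' ( H )") : type_scope.

Section BoundedOperatorRing.
Context {R : realType} {H : hilbertType R}.
Implicit Types A B C : 'B(H).

HB.instance Definition _ A :=
  GRing.isLinear.Build R[i] H H *:%R (bop_fun A) (bop_linear A).

HB.instance Definition _ := gen_eqMixin 'B(H).
HB.instance Definition _ := gen_choiceMixin 'B(H).

Lemma bopP A B : (forall x, A x = B x) -> A = B.
Proof.
case: A B => [f fl fb] [g gl gb] /= /funext fg; subst g.
by congr BoundedOperator; exact: Prop_irrelevance.
Qed.

Lemma bop_continuous A : continuous A.
Proof. exact/linear_bounded_continuous/bop_bounded. Qed.

Section Build.
Variables (f : H -> H) (fl : linear f) (fc : continuous f).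

HB.instance Definition _ := GRing.isLinear.Build R[i] H H *:%R f fl.

Lemma bop_of_bounded : bounded_near f (nbhs (0 : H)).
Proof. exact/linear_bounded_continuous. Qed.

Definition bop_of : 'B(H) := BoundedOperator fl bop_of_bounded.
End Build.

Lemma bop_zero_linear : linear (fun _ : H => 0 : H).
Proof. by move=> a x y; rewrite scaler0 addr0. Qed.

Lemma bop_one_linear : linear (fun x : H => x).
Proof. by []. Qed.

Lemma bop_add_linear A B : linear (fun x => A x + B x).
Proof. by move=> a x y; rewrite !linearP scalerDr addrACA. Qed.

Lemma bop_opp_linear A : linear (fun x => - A x).
Proof. by move=> a x y; rewrite linearP opprD scalerN. Qed.

Lemma bop_mul_linear A B : linear (fun x => A (B x)).
Proof. by move=> a x y; rewrite !linearP. Qed.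

Lemma bop_zero_continuous : continuous (fun _ : H => 0 : H).
Proof. by move=> x; exact: cvg_cst. Qed.

Lemma bop_one_continuous : continuous (fun x : H => x).
Proof. by move=> x; exact: cvg_id. Qed.

Lemma bop_add_continuous A B : continuous (fun x => A x + B x).
Proof. by move=> x; apply: cvgD; exact: bop_continuous. Qed.

Lemma bop_opp_continuous A : continuous (fun x => - A x).
Proof. by move=> x; apply: cvgN; exact: bop_continuous. Qed.

Lemma bop_mul_continuous A B : continuous (fun x => A (B x)).
Proof. by move=> x; apply: continuous_comp; exact: bop_continuous. Qed.

Definition bop_zero : 'B(H) := bop_of bop_zero_linear bop_zero_continuous.
Definition bop_one : 'B(H) := bop_of bop_one_linear bop_one_continuous.
Definition bop_add A B : 'B(H) :=
  bop_of (bop_add_linear A B) (bop_add_continuous (A := A) (B := B)).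
Definition bop_opp A : 'B(H) :=
  bop_of (bop_opp_linear A) (bop_opp_continuous (A := A)).
Definition bop_mul A B : 'B(H) :=
  bop_of (bop_mul_linear A B) (bop_mul_continuous (A := A) (B := B)).

Fact bop_addA : associative bop_add.
Proof. by move=> A B C; apply: bopP => x /=; rewrite addrA. Qed.
Fact bop_addC : commutative bop_add.
Proof. by move=> A B; apply: bopP => x /=; rewrite addrC. Qed.
Fact bop_add0 : left_id bop_zero bop_add.
Proof. by move=> A; apply: bopP => x /=; rewrite add0r. Qed.
Fact bop_addN : left_inverse bop_zero bop_opp bop_add.
Proof. by move=> A; apply: bopP => x /=; rewrite addNr. Qed.
Fact bop_mulA : associative bop_mul.
Proof. by move=> A B C; apply: bopP. Qed.
Fact bop_mul1 : left_id bop_one bop_mul.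
Proof. by move=> A; apply: bopP. Qed.
Fact bop_mulr1 : right_id bop_one bop_mul.
Proof. by move=> A; apply: bopP. Qed.
Fact bop_mulDl : left_distributive bop_mul bop_add.
Proof. by move=> A B C; apply: bopP. Qed.
Fact bop_mulDr : right_distributive bop_mul bop_add.
Proof. by move=> A B C; apply: bopP => x /=; rewrite linearD. Qed.

(* Not a nontrivial ring: H may be the zero space. *)
HB.instance Definition _ := GRing.isPzRing.Build 'B(H)
  bop_addA bop_addC bop_add0 bop_addN
  bop_mulA bop_mul1 bop_mulr1 bop_mulDl bop_mulDr.

End BoundedOperatorRing.

Section Adjoint.
Context {R : realType} {H : hilbertType R}.
Implicit Types A B C D : 'B(H).

Definition is_adjoint A B := forall x y : H, inner (A x) y = inner x (B y).

(* By the Riesz representation theorem, every bounded operator has exactly one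
   adjoint, so the default value 0 is never used. *)
Definition adjoint A : 'B(H) := xget 0 [set B | is_adjoint A B].

Definition generalized_projection B := B ^+ 2 = adjoint B.

Definition star_le C D :=
  C * adjoint C = D * adjoint C /\ adjoint C * C = adjoint C * D.

End Adjoint.

(* Main.v *)
Require Import Defs.
From mathcomp Require Import all_boot all_order all_algebra.
From mathcomp Require Import all_classical all_reals all_analysis.
From mathcomp Require Import sesquilinear complex.

Import GRing.Theory Num.Theory.
Local Open Scope ring_scope.

(** For a generalized projection [B] the adjoint is [B ^+ 2], so both [B B^*]
    and [B^* B] are the cube [P := B ^+ 3], and [B <=* A] reads
    [B ^+ 3 = A B ^+ 2 = B ^+ 2 A].  The theorem thus becomes a statement on
    two elements of a ring.

    If [B ^+ 3 = A B ^+ 2 = B ^+ 2 A], then multiplying by [B] shows that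
    [A - B] is annihilated by [P] on both sides, so that
    [(1 - P) (A - B) (1 - P) = A - B] and [X := A - B] is a witness.
    Conversely, [B ^+ 5 = B ^+ 2] says that [P] acts as the identity on
    [B ^+ 2], hence [(1 - P) X (1 - P)] is annihilated by [B ^+ 2] on both
    sides, and adding it to [B] changes neither [B * B ^+ 2] nor
    [B ^+ 2 * B].  This is [star_order_ringP].

    The identity [B ^+ 5 = B ^+ 2] is the only place where the inner product
    is used ([generalized_projection_expr5]): taking adjoints in [B ^+ 2 = B^*]
    gives [B ^+ 4 = (B^* )^+ 2 = (B ^+ 2)^* = B^** = B]. *)

(** The exponents are left as in [b * b ^+ 2] and [b ^+ 2 * b] so that
    [b ^+ 2] can be read as the adjoint of [b]. *)
Lemma star_order_ringP (K : pzRingType) (a b : K) (hb : b ^+ 5 = b ^+ 2) :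
  b * b ^+ 2 = a * b ^+ 2 /\ b ^+ 2 * b = b ^+ 2 * a <->
  exists x, a = b + (1 - b * b ^+ 2) * x * (1 - b ^+ 2 * b).
Proof.
rewrite -exprS -exprSr; split=> [[ab ba]|[x ->]].
  exists (a - b).
  have left0 : b ^+ 3 * (a - b) = 0.
    by rewrite mulrBr {1}exprS -mulrA -ba -exprS -exprSr subrr.
  have right0 : (a - b) * b ^+ 3 = 0.
    by rewrite mulrBl {1}exprSr mulrA -ab -exprS -exprSr subrr.
  by rewrite mulrBl mul1r left0 subr0 mulrBr mulr1 right0 subr0 addrC subrK.
have p0 : (1 - b ^+ 3) * b ^+ 2 = 0 by rewrite mulrBl mul1r -exprD hb subrr.
have p0' : b ^+ 2 * (1 - b ^+ 3) = 0 by rewrite mulrBr mulr1 -exprD hb subrr.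
split; first by rewrite mulrDl -exprS -!mulrA p0 !mulr0 addr0.
by rewrite mulrDr -exprSr !mulrA p0' !mul0r addr0.
Qed.

Section Adjoint.
Context {R : realType} {H : hilbertType R}.
Implicit Types (x y : H) (A B C : 'B(H)).

Lemma inner_conj x y : inner x y = (inner y x)^*.
Proof. by rewrite hermC /= expr0 mul1r. Qed.

(** The form is nondegenerate because it induces the norm: test against the
    difference of the two vectors. *)
Lemma inner_ext x y : (forall z, inner z x = inner z y) -> x = y.
Proof.
move=> xy; apply/eqP; rewrite -subr_eq0 -normr_eq0 -sqrf_eq0 -inner_normE.
by rewrite linearBr subr_eq0; apply/eqP; exact: xy.
Qed.

Lemma is_adjoint_sym A B : is_adjoint A B -> is_adjoint B A.
Proof. by move=> AB x y; rewrite inner_conj -AB -inner_conj. Qed.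

Lemma is_adjoint_uniq A B C : is_adjoint A B -> is_adjoint A C -> B = C.
Proof.
move=> adjB adjC; apply: bopP => y; apply: inner_ext => x.
by rewrite -adjB -adjC.
Qed.

Lemma is_adjoint_sqr A B : is_adjoint A B -> is_adjoint (A ^+ 2) (B ^+ 2).
Proof. by move=> AB x y; rewrite !expr2 /= !AB. Qed.

(** The weaker [B ^+ 5 = B ^+ 2] is stated in place of [B ^+ 4 = B] because it
    can be read off from both values that [adjoint B] may take by definition:
    an actual adjoint of [B], which gives [B ^+ 4 = B], or the default [0],
    which gives [B ^+ 2 = 0]. *)
Lemma generalized_projection_expr5 B :
  generalized_projection B -> B ^+ 5 = B ^+ 2.
Proof.
rewrite /generalized_projection /adjoint; case: xgetP => [C _ /= BC B2 | _ B2].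
  rewrite -{}B2 in BC.
  (* B ^+ 4 and B are both adjoints of B ^+ 2. *)
  have B4 : B ^+ 4 = B.
    rewrite (exprM B 2 2).
    exact: is_adjoint_uniq (is_adjoint_sqr _ _ BC) (is_adjoint_sym _ _ BC).
  by rewrite exprSr B4.
by rewrite (exprD B 2 3) B2 mul0r.
Qed.
End Adjoint.

Theorem theorem4p5 (R : realType) (H : hilbertType R) (A B : 'B(H))
    (hB : generalized_projection B) :
  star_le B A <->
  exists X : 'B(H),
    A = B + (1 - B * adjoint B) * X * (1 - adjoint B * B).
Proof.
have B5 := generalized_projection_expr5 _ hB.
by rewrite /star_le -hB; exact: star_order_ringP.
Qed.
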